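(* Let $G$ be a finite simple graph with vertex set $[n]$. Let $d$ be a non-negative integer such that the vertices $1,2,\ldots,d$ are pairwise adjacent. Let $q$ be an indeterminate and let $$\widehat{\chi}_d(q)=\frac{\chi_G(q)}{q(q-1)\cdots(q-d+1)},$$ with $\widehat\chi_0(q)=\chi_G(q)$. Then $\widehat\chi_d(q)$ is a polynomial in $q$, and for all non-negative integers $i,j$ the number $(-1)^{n-d-i}\widehat\chi_d^{(i)}(-j)$ equals the number of tuples $((V_1,\gamma_1),\ldots,(V_{d+i+j},\gamma_{d+i+j}))$ such that (1) $V_1,\ldots,V_{d+i+j}$ are pairwise disjoint subsets of $[n]$ with $\bigcup_kV_k=[n]$, and $k\in V_k$ for all $k\in[d]$; (2) for all $k\in[d+i+j]$, $\gamma_k$ is an acyclic orientation of the induced subgraph $G[V_k]$, and if $k\le d+i$ then $V_k\neq\emptyset$ and $\gamma_k$ has a unique source, which is $\min(V_k)$.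
   Context: $\chi_G$ is the chromatic polynomial of $G$; $\widehat\chi_d^{(i)}$ denotes the $i$-th derivative. A source of an orientation is a vertex with no ingoing edge; an orientation is acyclic if it has no directed cycle. *)

(* Defs.v *)
From HB Require Import structures.
From mathcomp Require Import all_boot all_order all_algebra.

Set Implicit Arguments.
Unset Strict Implicit.
Unset Printing Implicit Defensive.

Import GRing.Theory.
Local Open Scope ring_scope.

Definition proper_colorings (T : finType) (e : rel T) (k : nat) :
    {set {ffun T -> 'I_k}} :=
  [set f : {ffun T -> 'I_k} | [forall u, forall v, e u v ==> (f u != f v)]].

(* Colorings are grouped by their kernel K; those with kernel K are the
   injections into 'I_k of the set of K-classes. *)
Lemma chrom_poly_subproof (T : finType) (e : rel T) :
  {p : {poly int} | forall k : nat, p.[k%:R] = #|proper_colorings e k|%:R}.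
Proof.
pose ker k (f : {ffun T -> 'I_k}) := [set uv : T * T | f uv.1 == f uv.2].
pose cls (K : {set T * T}) u := [set v | (u, v) \in K].
pose D (K : {set T * T}) := [set cls K u | u in T].
pose isker (K : {set T * T}) := 
  [&& [forall u, (u, u) \in K],
      [forall u, forall v, ((u, v) \in K) ==> (cls K u == cls K v)]
    & [forall u, forall v, e u v ==> ((u, v) \notin K)]].
exists (\sum_(K | isker K) \prod_(m < #|D K|) ('X - (m%:R)%:P)) => k.
rewrite horner_sum.
have -> : #|proper_colorings e k| =
   (\sum_(K | isker K) #|[set f : {ffun T -> 'I_k} | ker k f == K]|)%N.
  rewrite -sum1_card (partition_big (@ker k) isker) /=; last first.
    move=> f; rewrite inE => /forallP pf; apply/and3P; split.
    - by apply/forallP => u; rewrite inE.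
    - apply/forallP => u; apply/forallP => v; apply/implyP; rewrite inE /=.
      by move=> /eqP fuv; apply/eqP/setP => w; rewrite !inE /= fuv.
    - apply/forallP => u; apply/forallP => v; rewrite inE.
      exact: (forallP (pf u)).
  apply: eq_bigr => K /and3P[_ _ /forallP eK].
  rewrite -sum1_card; apply: eq_bigl => f; rewrite !inE.
  case: eqP => [fK|]; rewrite ?andbF // andbT.
  apply/forallP => u; apply/forallP => v.
  by have /forallP/(_ v) := eK u; rewrite -fK inE.
rewrite natr_sum; apply: eq_bigr => K /and3P[/forallP Krefl /forallP Kcls _].
have KP u v : ((u, v) \in K) = (cls K u == cls K v).
  apply/idP/eqP => [uv|cuv].
    by apply/eqP; exact: (implyP (forallP (Kcls u) v)).
  have -> : ((u, v) \in K) = (v \in cls K u) by rewrite inE.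
  by rewrite cuv inE.
pose S := {C : {set T} | C \in D K}.
have clsD u : cls K u \in D K by apply: imset_f.
pose q u : S := exist _ (cls K u) (clsD u).
pose ext (g : {ffun S -> 'I_k}) := [ffun u => g (q u)].
have -> : #|[set f : {ffun T -> 'I_k} | ker k f == K]| = (k ^_ #|D K|)%N.
  transitivity #|[set g : {ffun S -> 'I_k} | injectiveb g]|; last first.
    by rewrite card_inj_ffuns card_ord card_sig; congr (_ ^_ _)%N; apply: eq_card.
  have repr (s : S) : exists u, q u == s.
    case: s => C CD; have /imsetP[u _ Cu] := CD.
    by exists u; apply/eqP/val_inj.
  have ext_inj : injective ext.
    move=> g h /ffunP gh; apply/ffunP => s.
    rewrite -(eqP (xchooseP (repr s))).
    by have := gh (xchoose (repr s)); rewrite !ffunE.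
  rewrite -(card_imset _ ext_inj); congr #|pred_of_set _|; apply/setP => f.
  rewrite inE; apply/eqP/imsetP.
    move=> fK.
    have fKE u v : ((u, v) \in K) = (f u == f v) by rewrite -fK inE.
    exists [ffun s => f (xchoose (repr s))].
      rewrite inE; apply/injectiveP => s t; rewrite !ffunE => fst.
      rewrite -(eqP (xchooseP (repr s))) -(eqP (xchooseP (repr t))).
      by apply/val_inj/eqP; rewrite -KP fKE fst.
    apply/ffunP => u; rewrite !ffunE.
    have := xchooseP (repr (q u)); rewrite -val_eqE /= -KP fKE.
    by move/eqP.
  case=> g; rewrite inE => /injectiveP gi ->; apply/setP => -[u v].
  by rewrite inE /= !ffunE KP (inj_eq gi) -val_eqE.
rewrite horner_prod; elim: #|D K| => [|m IHm]; first by rewrite big_ord0.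
rewrite big_ord_recr /= IHm hornerXsubC ffactnSr natrM.
have [mk|km] := leqP m k; first by rewrite natrB.
by rewrite ffact_small // !mul0r.
Qed.

Definition chrom_poly (T : finType) (e : rel T) : {poly int} :=
  sval (chrom_poly_subproof e).

Lemma chrom_polyE (T : finType) (e : rel T) (k : nat) :
  (chrom_poly e).[k%:R] = #|proper_colorings e k|%:R.
Proof. exact: (svalP (chrom_poly_subproof e)). Qed.

(* An orientation of the induced subgraph on V is given by its set A of arcs:
   (u, v) \in A means that the edge uv is directed from u to v. *)
Definition is_orientation (T : finType) (e : rel T) (V : {set T})
    (A : {set T * T}) : bool :=
  [forall u, forall v,
     if [&& u \in V, v \in V & e u v]
     then ((u, v) \in A) (+) ((v, u) \in A)
     else (u, v) \notin A].

Definition arc (T : finType) (A : {set T * T}) : rel T :=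
  fun u v => (u, v) \in A.

Definition is_acyclic (T : finType) (A : {set T * T}) : bool :=
  [forall u, forall v, arc A u v ==> ~~ connect (arc A) v u].

Lemma is_acyclicP (T : finType) (A : {set T * T}) :
  reflect (forall c : seq T, cycle (arc A) c -> c = [::]) (is_acyclic A).
Proof.
apply: (iffP forallP) => [acA [//|u c] /= | acA u].
  case: c => [|v c] /=.
    rewrite andbT => uu; have /forallP/(_ u) := acA u.
    by rewrite uu connect0.
  rewrite rcons_path => /and3P[uv vc cu].
  have /forallP/(_ v) := acA u; rewrite uv => /negP[].
  apply: (connect_trans (y := last v c)); last exact: connect1.
  by apply/connectP; exists c.
apply/forallP => v; apply/implyP => uv; apply/negP => /connectP[p vp up].
have : cycle (arc A) (v :: p) by rewrite /= rcons_path vp -up.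
by move/acA.
Qed.

Definition sources (T : finType) (V : {set T}) (A : {set T * T}) : {set T} :=
  [set v in V | [forall u, ~~ arc A u v]].

Definition is_min (n : nat) (V : {set 'I_n}) (m : 'I_n) : bool :=
  (m \in V) && [forall v in V, (m <= v)%N].

(* The vertex k of [n] is the ordinal of value k - 1, and likewise for the
   position k of a tuple. *)
Definition decompositions (n : nat) (e : rel 'I_n) (d i j : nat) :
    {set (d + i + j).-tuple ({set 'I_n} * {set 'I_n * 'I_n})} :=
  [set t : (d + i + j).-tuple ({set 'I_n} * {set 'I_n * 'I_n}) |
    let V k := (tnth t k).1 in
    let g k := (tnth t k).2 in
    [&& [forall k, forall l, (k != l) ==> [disjoint V k & V l]],
        \bigcup_k V k == [set: 'I_n],
        [forall k : 'I_(d + i + j), forall v : 'I_n,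
           ((k < d)%N && (v == k :> nat)) ==> (v \in V k)]
      & [forall k : 'I_(d + i + j),
           [&& is_orientation e (V k) (g k),
               is_acyclic (g k)
             & (k < d + i)%N ==>
                 (V k != set0) &&
                 [exists m, is_min (V k) m && (sources (V k) (g k) == [set m])]]]]].

(* Main.v *)
From HB Require Import structures.
Require Import Defs.
From mathcomp Require Import all_boot all_order all_algebra.
From mathcomp Require Import ring zify.

Set Implicit Arguments.
Unset Strict Implicit.
Unset Printing Implicit Defensive.

Import GRing.Theory.
Local Open Scope ring_scope.

(* Functions on the subsets of [n] form a commutative ring under the product
   (f * g)(V) = sum over W of f(W) g(V minus W), on which the operators
   (euler v f)(V) = [v in V] f(V) are derivations. Let A(V) be the number of
   acyclic orientations of G[V] and I(V) = (-1)^|V| [V independent].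
   Inclusion-exclusion over sets of sources gives A * I = 1 and shows that
   B_v = euler v A * I counts the acyclic orientations with unique source v.
   Since the colorings in k colors are counted, up to sign, by I^k, there are
   polynomials P_V with P_V(m) = A^m(V) for every integer m and
   chi_G(q) = (-1)^n P_[n](-q); as euler v (A^m) = m B_v A^m, the family P
   behaves as exp(q L), where L is characterized by L(empty) = 0 and
   euler v L = B_v. In particular L(V) counts the acyclic orientations of G[V]
   with unique source min V, and P' = L P.
   If v and w are adjacent, then euler w (euler v I) = 0, that is,
   euler w B_v = B_v B_w. Hence applying euler 1, .., euler d to P yields
   q(q+1)..(q+d-1) B_1 .. B_d P, so the i-th derivative of the quotient at j is
   the coefficient of B_1 .. B_d L^i A^j at [n], which counts the tuples. *)

(** * The convolution ring of set functions *)

Section SetFun.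
Variables (T : finType) (R : comNzRingType).
(** A separate type name, so that the ring product is convolution rather than the pointwise product
    of finite functions. *)
Definition setfun : Type := {ffun {set T} -> R}.
Implicit Types f g h : setfun.
HB.instance Definition _ := GRing.Zmodule.on setfun.

Definition conv f g : setfun :=
  [ffun V : {set T} => \sum_(W : {set T} | W \subset V) f W * g (V :\: W)].
Definition setfun1 : setfun := [ffun V : {set T} => (V == set0)%:R].

Fact convC : commutative conv.
Proof.
move=> f g; apply/ffunP => V; rewrite !ffunE.
rewrite (reindex_onto (fun W => V :\: W) (fun W => V :\: W)) /=; last first.
  by move=> W WV; rewrite setDDr setDv set0U; apply/setIidPr.
apply: eq_big => [W|W /andP[_ /eqP {3}<-]]; last first.
  by rewrite mulrC setDDr setDv set0U.
rewrite subsetDl /= setDDr setDv set0U; exact: (sameP eqP setIidPr).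
Qed.

Fact convA : associative conv.
Proof.
move=> f g h; apply/ffunP => V; rewrite !ffunE.
under [RHS]eq_bigr do rewrite ffunE mulr_suml.
rewrite (exchange_big_dep (fun W : {set T} => W \subset V)) /=; last first.
  by move=> S W SV WS; apply: subset_trans SV.
apply: eq_bigr => W WV; rewrite ffunE mulr_sumr.
(* Both sides sum over ordered partitions of [V] into three possibly empty blocks; the larger set
   [S] is traded for its part outside [W]. *)
rewrite [RHS](reindex_onto (fun U => W :|: U) (fun S => S :\: W)) /=; last first.
  by move=> S /andP[_ WS]; rewrite setDE setUIr setUCr setIT; apply/setUidPr.
apply: eq_big => [U|U].
  rewrite subUset subsetUl WV /= andbT setDUl setDv set0U subsetD.
  by congr (_ && _); apply/setDidPl/eqP.
rewrite subsetD => /andP[_ /setDidPl UW].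
by rewrite mulrA setDDl setDUl setDv set0U UW.
Qed.

Fact conv1 : left_id setfun1 conv.
Proof.
move=> f; apply/ffunP => V; rewrite ffunE (bigD1 set0) ?sub0set //=.
rewrite ffunE eqxx mul1r setD0 big1 ?addr0 // => W /andP[_ /negPf W0].
by rewrite ffunE W0 mul0r.
Qed.

Fact convDl : left_distributive conv +%R.
Proof.
move=> f g h; apply/ffunP => V; rewrite !ffunE -big_split /=.
by apply: eq_bigr => W _; rewrite ffunE mulrDl.
Qed.

Fact setfun1_neq0 : setfun1 != 0.
Proof.
apply/eqP => /ffunP/(_ set0); rewrite !ffunE eqxx => /eqP.
by rewrite oner_eq0.
Qed.

HB.instance Definition _ := GRing.Zmodule_isComNzRing.Build setfun
  convA convC conv1 convDl setfun1_neq0.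

Lemma setfunM f g V :
  (f * g : setfun) V = \sum_(W : {set T} | W \subset V) f W * g (V :\: W).
Proof. by rewrite ffunE. Qed.
Lemma setfun1E V : (1 : setfun) V = (V == set0)%:R.
Proof. by rewrite ffunE. Qed.

End SetFun.

(** * Euler operators, scalars and expansion of products *)

Section SetFunTheory.
Variables (T : finType) (R : comNzRingType).
Implicit Types (f g b F : setfun T R) (v w : T) (V W S : {set T}).

Definition euler v f : setfun T R := [ffun V : {set T} => f V *+ (v \in V)].

Lemma eulerE v f V : euler v f V = f V *+ (v \in V).
Proof. by rewrite ffunE. Qed.

Lemma eulerM v f g : euler v (f * g) = euler v f * g + f * euler v g.
Proof.
apply/ffunP => V; rewrite eulerE [in RHS]ffunE !setfunM -big_split -sumrMnl /=.
apply: eq_bigr => W WV; rewrite !eulerE in_setD.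
have := subsetP WV v; case: (v \in W) => [->//|_] /=.
  by rewrite mulr0n mulr0 addr0.
by rewrite mulr0n mul0r add0r mulrnAr.
Qed.

Lemma eulerD v f g : euler v (f + g) = euler v f + euler v g.
Proof. by apply/ffunP => V; rewrite !ffunE mulrnDl. Qed.

Lemma eulerN v f : euler v (- f) = - euler v f.
Proof. by apply/ffunP => V; rewrite !ffunE mulNrn. Qed.

Lemma euler1 v : euler v 1 = 0.
Proof.
apply/ffunP => V; rewrite eulerE setfun1E ffunE.
by case: eqP => [->|_]; rewrite ?inE // mul0rn.
Qed.

Lemma euler_exp v b f k :
  euler v f = b * f -> euler v (f ^+ k) = b * f ^+ k *+ k.
Proof.
move=> Ef; elim: k => [|k IHk]; first by rewrite expr0 euler1.
by rewrite exprS eulerM IHk Ef; ring.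
Qed.

(** Scalars sit in the ring as multiples of the unit, so that scaling by an element of [R] is itself
    a product. *)
Definition setfun_const (c : R) : setfun T R :=
  [ffun V : {set T} => c *+ (V == set0)].

Lemma setfun_const_mulE c f V : (setfun_const c * f) V = c * f V.
Proof.
rewrite setfunM (bigD1 set0) ?sub0set //= ffunE eqxx setD0 big1 ?addr0 //.
by move=> W /andP[_ /negPf W0]; rewrite ffunE W0 mul0r.
Qed.

Lemma setfun_const_natr k : setfun_const k%:R = k%:R.
Proof.
apply/ffunP => V; rewrite ffunE -mulrnA mulnC mulrnA -setfun1E.
by elim: k => [|k IHk]; rewrite ?mulr0n ?mulrS [RHS]ffunE -?IHk.
Qed.

Lemma setfun_constD c1 c2 :
  setfun_const (c1 + c2) = setfun_const c1 + setfun_const c2.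
Proof. by apply/ffunP => V; rewrite !ffunE mulrnDl. Qed.

(** Uniqueness for Euler equations, by induction on [#|V|]: for [v] in [V] the equation expresses
    [F V] through the values of [F] at [V :\: W], where only nonempty [W] matter because
    [b v set0 = 0]. *)
Lemma eq_setfun0 (c : R) (b : T -> setfun T R) F :
    (forall v, b v set0 = 0) -> F set0 = 0 ->
    (forall v, euler v F = setfun_const c * b v * F) ->
  F = 0.
Proof.
move=> b0 F0 EF; apply/ffunP => V; rewrite [RHS]ffunE.
have [m] := ubnP #|V|; elim: m V => // m IHm V; rewrite ltnS => Vm.
have [->//|/set0Pn[v vV]] := eqVneq V set0.
have /ffunP/(_ V) := EF v; rewrite eulerE vV mulr1n => ->.
rewrite -mulrA setfun_const_mulE setfunM big1 ?mulr0 // => W WV.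
have [->|W0] := eqVneq W set0; first by rewrite b0 mul0r.
rewrite IHm ?mulr0 // (leq_trans _ Vm) // cardsD (setIidPr WV).
have : (0 < #|W|)%N by rewrite card_gt0.
have := subset_leq_card WV; lia.
Qed.

Definition set_delta S : setfun T R := [ffun V : {set T} => (V == S)%:R].

Lemma set_deltaM V W :
  set_delta V * set_delta W =
  if [disjoint V & W] then set_delta (V :|: W) else 0.
Proof.
apply/ffunP => S; rewrite setfunM.
have [VS|VS] := boolP (V \subset S); last first.
  rewrite big1 => [|U US]; last first.
    rewrite ffunE; case: eqP => [UV|_]; last by rewrite mul0r.
    by rewrite -UV US in VS.
  case: ifP => _; rewrite ffunE //.
  by case: eqP => // SE; rewrite SE subsetUl in VS.
rewrite (bigD1 V) //= !ffunE eqxx mul1r big1 ?addr0; last first.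
  by move=> U /andP[_ /negPf UV]; rewrite ffunE UV mul0r.
case: ifP => dVW; rewrite ffunE.
  congr (nat_of_bool _)%:R; apply/eqP/eqP => [<-|->].
    by rewrite setDE setUIr setUCr setIT; apply/esym/setUidPr.
  by rewrite setDUl setDv set0U; apply/setDidPl; rewrite disjoint_sym.
case: eqP => // SW; move: dVW.
by rewrite -SW disjoint_sym -setI_eq0 setDE -setIA (setIC (~: V))
  setICr setI0 eqxx.
Qed.

Lemma setfun_sum_delta f : f = \sum_S setfun_const (f S) * set_delta S.
Proof.
apply/ffunP => V; rewrite sum_ffunE (bigD1 V) //= big1 => [|S /negPf SV].
  by rewrite setfun_const_mulE ffunE eqxx mulr1 addr0.
by rewrite setfun_const_mulE ffunE eq_sym SV mulr0.
Qed.

Definition disjoint_cover m (t : {ffun 'I_m -> {set T}}) S :=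
  [forall k, forall l, (k != l) ==> [disjoint t k & t l]]
    && (\bigcup_k t k == S).

Lemma prod_set_delta m (t : {ffun 'I_m -> {set T}}) S :
  (\prod_k set_delta (t k)) S = (disjoint_cover t S)%:R.
Proof.
pose r k l := [disjoint t k & t l].
have disjU k s : [disjoint t k & \bigcup_(l <- s) t l] = all (r k) s.
  elim: s => [|l s IHs]; first by rewrite big_nil -setI_eq0 setI0 eqxx.
  by rewrite big_cons disjoints_subset setCU subsetI -!disjoints_subset IHs.
have prodE s : \prod_(k <- s) set_delta (t k) =
    if pairwise r s then set_delta (\bigcup_(k <- s) t k) else 0.
  elim: s => [|k s IHs].
    by rewrite !big_nil; apply/ffunP => V; rewrite !ffunE.
  rewrite !big_cons IHs pairwise_cons.
  case: ifP => _; last by rewrite andbF mulr0.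
  by rewrite set_deltaM disjU andbT.
rewrite prodE; have -> : disjoint_cover t S =
    pairwise r (index_enum 'I_m) && (\bigcup_k t k == S).
  (* [r k k] can fail, so the diagonal is added in [r']; as the enumeration has no repetition,
     [pairwise] is unchanged, and it now amounts to a condition on all pairs. *)
  congr (_ && _); pose r' k l := (k == l) || r k l.
  have -> : pairwise r (index_enum 'I_m) = pairwise r' (index_enum 'I_m).
    have := index_enum_uniq 'I_m; rewrite uniq_pairwise.
    elim: index_enum => //= k s IHs /andP[/allP ks us].
    rewrite IHs //; congr (_ && _); apply: eq_in_all => l /ks /=.
    by rewrite /r' => /negPf ->.
  rewrite pairwise_all2rel; last 2 first.
  - by move=> k; rewrite /r' eqxx.
  - by move=> k l; rewrite /r' /r eq_sym disjoint_sym.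
  apply/forallP/allrelP => [h k l _ _|h k].
    rewrite /r'; case: eqVneq => //= kl.
    by have /forallP/(_ l) := h k; rewrite kl.
  apply/forallP => l; apply/implyP => /negPf kl.
  by have := h k l (mem_index_enum _) (mem_index_enum _); rewrite /r' kl.
by case: pairwise; rewrite ffunE // eq_sym.
Qed.

(** Each factor is expanded in the point masses [set_delta] and the product is distributed;
    [prod_set_delta] then selects the families that partition [S], empty blocks allowed. *)
Lemma setfun_prodE m (f : 'I_m -> setfun T R) S :
  (\prod_k f k) S =
  \sum_(t : {ffun 'I_m -> {set T}} | disjoint_cover t S) \prod_k f k (t k).
Proof.
under eq_bigr do rewrite [f _]setfun_sum_delta.
rewrite bigA_distr_bigA /= sum_ffunE [RHS]big_mkcond /=.
apply: eq_bigr => t _; rewrite big_split /=.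
have -> : \prod_i setfun_const (f i (t i)) = setfun_const (\prod_i f i (t i)).
  apply: (big_rec2 (fun x c => x = setfun_const c)) => [|k x c _ ->].
    by rewrite (setfun_const_natr 1).
  apply/ffunP => V; rewrite setfun_const_mulE !ffunE mulrnAr //.
by rewrite setfun_const_mulE prod_set_delta; case: ifP; rewrite ?mulr1 ?mulr0.
Qed.

End SetFunTheory.

(** * Change of coefficients *)

Section SetFunMap.
Variables (T : finType) (R S : comNzRingType) (phi : {rmorphism R -> S}).
Implicit Types f g : setfun T R.

Definition setfun_map f : setfun T S := [ffun V : {set T} => phi (f V)].

Lemma setfun_mapM f g : setfun_map (f * g) = setfun_map f * setfun_map g.
Proof.
apply/ffunP => V; rewrite setfunM ffunE setfunM rmorph_sum.
by apply: eq_bigr => W _; rewrite !ffunE rmorphM.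
Qed.

Lemma euler_map v f : euler v (setfun_map f) = setfun_map (euler v f).
Proof. by apply/ffunP => V; rewrite !ffunE rmorphMn. Qed.

End SetFunMap.

(** * Integer powers of an invertible set function *)

Section IntegerPowers.
Variables (T : finType) (A I : setfun T int).
Hypothesis AI : A * I = 1.

(** [I] is the inverse of [A], and [Negz k] is the integer -(k+1), whence the exponent [k.+1]. *)
Definition zpow (m : int) : setfun T int :=
  match m with Posz k => A ^+ k | Negz k => I ^+ k.+1 end.

(** The logarithmic derivative of [A]: multiplying by [I] divides by [A]. *)
Definition logder v : setfun T int := euler v A * I.

(** Apply [euler v] to [A * I = 1] and multiply by [I]. *)
Lemma logder_inv v : euler v I = - logder v * I.
Proof.
have /eqP : euler v (A * I) = 0 by rewrite AI euler1.
rewrite eulerM addr_eq0 => /eqP /(congr1 (fun x => x * I)) EI.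
rewrite -[LHS]mul1r -AI /logder.
rewrite [LHS](_ : _ = A * euler v I * I); last by ring.
by rewrite !mulNr EI mulNr opprK.
Qed.

Lemma euler_zpow v m : euler v (zpow m) = logder v * zpow m *~ m.
Proof.
case: m => k; rewrite /zpow.
  by apply: euler_exp; rewrite /logder -mulrA (mulrC I) AI mulr1.
rewrite (euler_exp k.+1 (logder_inv v)) NegzE mulrNz mulNr mulNrn.
by [].
Qed.

Hypothesis A0 : A set0 = 1.

Lemma expr_set0 (f : setfun T int) k : f set0 = 1 -> (f ^+ k) set0 = 1.
Proof.
move=> f0; elim: k => [|k IHk]; first by rewrite setfun1E eqxx.
rewrite exprS setfunM (big_pred1 set0) ?set0D ?f0 ?IHk // => W.
by rewrite subset0.
Qed.

Lemma zpow_set0 m : zpow m set0 = 1.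
Proof.
have I0 : I set0 = 1.
  have /ffunP/(_ set0) := AI; rewrite setfunM setfun1E eqxx.
  rewrite (big_pred1 set0) ?set0D ?A0 ?mul1r // => W.
  by rewrite subset0.
by case: m => k; apply: expr_set0.
Qed.

Lemma logder_set0 v : logder v set0 = 0.
Proof.
rewrite setfunM (big_pred1 set0) => [|W]; last by rewrite subset0.
by rewrite eulerE inE mul0r.
Qed.

(* Comparing coefficients in euler v (zpow m) = m * logder v * zpow m expresses
   zpow m V through smaller sets, with a polynomial dependence on m. *)
Lemma zpow_poly : exists P : {ffun {set T} -> {poly int}},
  forall (m : int) V, (P V).[m] = zpow m V.
Proof.
suff polyP V : exists p : {poly int}, forall m : int, p.[m] = zpow m V.
  have [P PP] := fin_all_exists polyP.
  by exists [ffun V => P V] => m V; rewrite ffunE.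
have [k] := ubnP #|V|; elim: k V => // k IHk V; rewrite ltnS => Vk.
have [->|/set0Pn[v vV]] := eqVneq V set0.
  by exists 1 => m; rewrite hornerC zpow_set0.
have polyW (W : {set T}) : exists p : {poly int},
    (W != set0) && (W \subset V) -> forall m : int, p.[m] = zpow m (V :\: W).
  case: andP => [[W0 WV]|_]; last by exists 0.
  have [|p pP] := IHk (V :\: W); last by exists p.
  rewrite (leq_trans _ Vk) // cardsD (setIidPr WV).
  have : (0 < #|W|)%N by rewrite card_gt0.
  have := subset_leq_card WV; lia.
have [p pP] := fin_all_exists polyW.
(* [p set0] is unconstrained, but its coefficient [logder v set0] is zero; the other terms come from
   the induction hypothesis at the smaller sets [V :\: W]. *)
exists ('X * \sum_(W : {set T} | W \subset V) (logder v W)%:P * p W) => m.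
have /ffunP/(_ V) := euler_zpow v m.
rewrite eulerE vV mulr1n => ->.
rewrite hornerM hornerX horner_sum -mulrzl.
have -> (g : setfun T int) : (m%:~R * g) V = m * g V.
  rewrite -setfun_const_mulE; congr ((_ * g) V).
  case: m => n; rewrite ?NegzE ?mulrNz -pmulrn -setfun_const_natr natz //.
  by apply/ffunP => U; rewrite !ffunE mulNrn.
rewrite setfunM; congr (_ * _); apply: eq_bigr => W WV.
rewrite hornerM hornerC; have [->|W0] := eqVneq W set0.
  by rewrite logder_set0 !mul0r.
by rewrite pP // W0 WV.
Qed.

End IntegerPowers.

(** * Acyclic orientations and their sources *)

Section AcyclicOrientations.
Variables (T : finType) (e : rel T).
Hypothesis e_sym : symmetric e.
Implicit Types (u v w : T) (U V W Z : {set T}) (g : {set T * T}).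

Definition acyclic_orientations V : {set {set T * T}} :=
  [set g | is_orientation e V g && is_acyclic g].

Definition independent W := [forall u in W, forall v in W, ~~ e u v].

Lemma independentP W :
  reflect {in W &, forall u v, ~~ e u v} (independent W).
Proof.
apply: (iffP forall_inP) => [h u v uW vW|h u uW].
  by have /forall_inP := h u uW; apply.
by apply/forall_inP => v vW; apply: h.
Qed.

Lemma is_orientationP V g :
  reflect ((forall u v, (u, v) \in g -> [&& u \in V, v \in V & e u v]) /\
           (forall u v, u \in V -> v \in V -> e u v ->
              ((u, v) \in g) (+) ((v, u) \in g)))
          (is_orientation e V g).
Proof.
apply: (iffP forallP) => [h|[h1 h2] u].
  split=> u v; have /forallP/(_ v) := h u.
    by case: ifP => // _ /negPf ->.
  by move=> + uV vV uv; rewrite uV vV uv.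
apply/forallP => v; case: ifP => [/and3P[uV vV uv]|/negP uv].
  exact: h2.
by apply/negP => /h1.
Qed.

Lemma is_acyclicS g1 g2 : g1 \subset g2 -> is_acyclic g2 -> is_acyclic g1.
Proof.
move=> /subsetP g12 /forallP ac2; apply/forallP => u; apply/forallP => v.
apply/implyP => /g12 uv; have /forallP/(_ v)/implyP/(_ uv) := ac2 u.
apply: contra; apply: connect_sub => x y xy.
exact/connect1/g12.
Qed.

Lemma sourcesP V g v :
  reflect (v \in V /\ forall u, (u, v) \notin g) (v \in sources V g).
Proof.
by rewrite inE; apply: (iffP andP) => -[vV /forallP].
Qed.

(** A vertex that reaches the largest number of vertices is a source: a predecessor would reach
    strictly more, since by acyclicity it is not reached itself. *)
Lemma sources_neq0 V g :
  g \in acyclic_orientations V -> V != set0 -> sources V g != set0.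
Proof.
rewrite inE => /andP[/is_orientationP[gV _] /forallP ac] /set0Pn[x xV].
pose reach v := [set w | connect (Defs.arc g) v w].
have [v vV vmax] := @arg_maxnP _ x [in V] (fun v => #|reach v|) xV.
apply/set0Pn; exists v; apply/sourcesP; split=> // u; apply/negP => uv.
have /and3P[uV _ _] := gV _ _ uv.
suff /proper_card : reach v \proper reach u.
  by have /= := vmax u uV; rewrite ltnNge => ->.
apply/properP; split.
  apply/subsetP => w; rewrite !inE; apply: connect_trans; exact: connect1.
exists u; rewrite inE ?connect0 //.
by have /forallP/(_ v)/implyP/(_ uv) := ac u.
Qed.

Definition outward V W : {set T * T} :=
  [set uv | [&& uv.1 \in W, uv.2 \in V :\: W & e uv.1 uv.2]].

(** If [W] consists of sources, no edge lies inside [W] and every edge between [W] and the rest must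
    leave [W], so only the rest remains to be oriented. Conversely, adding these forced arcs creates
    no cycle, because no arc enters [W]. *)
Lemma card_acyclic_sources V W : W \subset V ->
  #|[set g in acyclic_orientations V | W \subset sources V g]| =
  if independent W then #|acyclic_orientations (V :\: W)| else 0%N.
Proof.
move=> /subsetP WV; case: ifP => [/independentP Windep|/negP Wdep]; last first.
  apply/eqP; rewrite cards_eq0; apply/eqP/setP => g; rewrite !inE; apply/negP.
  case/andP => /andP[/is_orientationP[gV gE] _] /subsetP Wg.
  apply: Wdep; apply/independentP => u v uW vW; apply/negP => uv.
  have := gE u v (WV _ uW) (WV _ vW) uv.
  have /sourcesP[_ /(_ v)/negPf ->] := Wg u uW.
  by have /sourcesP[_ /(_ u)/negPf ->] := Wg v vW.
have noin g u v : g \in acyclic_orientations (V :\: W) ->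
    (u, v) \in g :|: outward V W -> v \notin W.
  rewrite inE => /andP[/is_orientationP[gV _] _].
  by rewrite !inE => /orP[/gV|] /and3P[_]; rewrite ?inE => /andP[].
(* A path that starts outside [W] stays outside, so it never uses a forced arc. *)
have noinC g u v : g \in acyclic_orientations (V :\: W) -> u \notin W ->
    connect (Defs.arc (g :|: outward V W)) u v ->
    (v \notin W) && connect (Defs.arc g) u v.
  move=> gA uW /connectP[p + ->].
  elim: p u uW => [|w p IHp] u uW /=; first by rewrite uW connect0.
  case/andP => uw wp; have wW := noin _ _ _ gA uw.
  have /andP[-> pc] := IHp w wW wp; apply: connect_trans pc.
  by apply/connect1; move: uw; rewrite /Defs.arc !inE /= (negPf uW) orbF.
rewrite -[RHS](card_in_imset (f := fun g => g :|: outward V W)); last first.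
  move=> g h; rewrite !inE => /andP[/is_orientationP[gV _] _].
  move=> /andP[/is_orientationP[hV _] _] gh; apply/setP => -[u v].
  have /setP/(_ (u, v)) := gh; rewrite !inE /=.
  have [uW|_] := boolP (u \in W); last by rewrite !orbF.
  by move=> _; apply/idP/idP => [/gV|/hV] /and3P[]; rewrite inE uW.
congr #|pred_of_set _|; apply/setP => g; apply/idP/imsetP.
  rewrite !inE => /andP[/andP[/is_orientationP[gV gE] gac] /subsetP gW].
  have gWout u v : (u, v) \in g -> v \notin W.
    by move=> uv; apply/negP => /gW/sourcesP[_ /(_ u)]; rewrite uv.
  (* The inverse map discards the arcs whose tail lies in [W]; [outward] restores them. *)
  exists (g :&: setX (~: W) setT).
    rewrite inE; apply/andP; split; last first.
      by apply: is_acyclicS gac; exact: subsetIl.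
    apply/is_orientationP; split=> u v; rewrite !inE.
      case/andP => uv /andP[uW _]; rewrite uW (gWout _ _ uv).
      exact: gV.
    move=> /andP[uW uV] /andP[vW vV] uv; rewrite uW vW !andbT.
    exact: gE.
  apply/setP => -[u v]; rewrite !inE /= andbT.
  have [uW|uW] := boolP (u \in W); last by rewrite andbT orbF.
  rewrite andbF /=; apply/idP/idP => [uv|/andP[/andP[vW vV] uv]].
    by rewrite (gWout _ _ uv); have /and3P[_ -> ->] := gV _ _ uv.
  have := gE u v (WV _ uW) vV uv.
  by have /sourcesP[_ /(_ v)/negPf ->] := gW u uW; rewrite addbF.
case=> h hA ->; have /andP[/is_orientationP[hV hE] hac] :
  is_orientation e (V :\: W) h && is_acyclic h by move: hA; rewrite inE.
rewrite !inE; apply/andP; split; last first.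
  apply/subsetP => v vW; apply/sourcesP; split=> [|u]; first exact: WV.
  by apply/negP => /(noin _ _ _ hA); rewrite vW.
apply/andP; split.
  apply/is_orientationP; split=> u v; rewrite !inE /=.
    case/orP => [/hV/and3P[]|/and3P[uW /andP[_ ->] ->]].
      by rewrite !inE => /andP[_ ->] /andP[_ ->] ->.
    by rewrite WV.
  move=> uV vV uv; rewrite (e_sym v u) uv uV vV !andbT.
  have [uW|uW] := boolP (u \in W); have [vW|vW] := boolP (v \in W) => /=.
  - by have := Windep u v uW vW; rewrite uv.
  - rewrite orbT orbF; have [/hV|//] := boolP ((v, u) \in h).
    by rewrite !inE uW andbF.
  - rewrite orbT orbF; have [/hV|//] := boolP ((u, v) \in h).
    by rewrite !inE vW andbF.
  - by rewrite !orbF hE // inE ?uW ?vW.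
apply/forallP => u; apply/forallP => v; apply/implyP => uv; apply/negP => vu.
have vW := noin _ _ _ hA uv.
have /andP[uW vuh] := noinC _ _ _ hA vW vu.
have uvh : (u, v) \in h by move: uv; rewrite /Defs.arc !inE /= (negPf uW) orbF.
by have /forallP/(_ u)/forallP/(_ v) := hac; rewrite /Defs.arc uvh vuh.
Qed.

(** Expand the product over all vertices of 1 - [v in U], which has a zero factor as soon as [U] is
    nonempty. *)
Lemma sum_sign_subsets U :
  \sum_(W : {set T} | W \subset U) (-1) ^+ #|W| = (U == set0)%:R :> int.
Proof.
transitivity (\prod_(v : T) (- (v \in U)%:R + 1) : int).
  rewrite bigA_distr big_mkcond /=; apply: eq_bigr => W _.
  have [WU|/subsetPn[v vW vU]] := boolP (W \subset U).
    rewrite -big_mkcond /= -prodr_const; apply: eq_bigr => v vW.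
    by rewrite (subsetP WU).
  by rewrite (bigD1 v) //= vW (negPf vU) oppr0 mul0r.
have [->|/set0Pn[v vU]] := eqVneq U set0.
  by rewrite big1 // => v _; rewrite inE oppr0 add0r.
by rewrite (bigD1 v) //= vU addNr mul0r.
Qed.

Definition acyclic_fun : setfun T int :=
  [ffun V : {set T} => #|acyclic_orientations V|%:R].
Definition independent_fun : setfun T int :=
  [ffun V : {set T} => (independent V)%:R].
Definition signed_independent_fun : setfun T int :=
  [ffun V : {set T} => (-1) ^+ #|V| *+ independent V].

(* Inclusion-exclusion over the sets W of sources lying in Z. *)
Lemma sum_sources V Z :
  \sum_(W : {set T} | (W \subset V) && (W \subset Z))
     signed_independent_fun W * acyclic_fun (V :\: W) =
  #|[set g in acyclic_orientations V | [disjoint sources V g & Z]]|%:R.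
Proof.
rewrite -sum1_card natr_sum.
under [RHS]eq_bigl do rewrite inE.
rewrite [RHS]big_mkcondr /=.
transitivity (\sum_(g in acyclic_orientations V)
    \sum_(W : {set T} | W \subset sources V g :&: Z) (-1) ^+ #|W| : int).
  rewrite (exchange_big_dep (fun W : {set T} => (W \subset V) && (W \subset Z)));
    last first.
    move=> g W _; rewrite subsetI => /andP[Wg ->]; rewrite andbT.
    apply: subset_trans Wg _; apply/subsetP => v; by rewrite inE => /andP[].
  apply: eq_bigr => W /andP[WV WZ]; rewrite !ffunE.
  transitivity ((-1) ^+ #|W| *
     #|[set g in acyclic_orientations V | W \subset sources V g]|%:R : int).
    rewrite card_acyclic_sources //; case: ifP => _ //.
    by rewrite mul0r mulr0.
  rewrite -[X in _ * X%:R]sum1_card natr_sum mulr_sumr.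
  apply: eq_big => [g|g _]; last by rewrite mulr1.
  by rewrite inE subsetI WZ andbT.
apply: eq_bigr => g gA.
by rewrite sum_sign_subsets setI_eq0; case: ifP.
Qed.

(** With [Z] the whole vertex set, [sum_sources] counts the acyclic orientations without sources,
    and these exist only on the empty set. *)
Lemma acyclic_funM : acyclic_fun * signed_independent_fun = 1.
Proof.
apply/ffunP => V; rewrite mulrC setfunM setfun1E.
have /= := sum_sources V setT.
under eq_bigl do rewrite subsetT andbT.
move=> ->; have [->|V0] := eqVneq V set0.
  rewrite (_ : [set g in _ | _] = [set set0]) ?cards1 //.
  apply/setP => g; rewrite !inE; apply/idP/eqP => [|->].
    case/andP => /andP[/is_orientationP[gV _] _] _; apply/setP => -[u v].
    by rewrite inE; apply/negP => /gV; rewrite inE.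
  rewrite -setI_eq0 setIT; apply/andP; split; last first.
    by apply/eqP/setP => v; rewrite !inE.
  apply/andP; split.
    by apply/is_orientationP; split=> u v; rewrite inE.
  by apply/forallP => u; apply/forallP => v; rewrite /Defs.arc inE.
rewrite (_ : [set g in _ | _] = set0) ?cards0 //.
apply/setP => g; rewrite in_set0 inE; apply/negP => /andP[gA].
by rewrite -setI_eq0 setIT; apply/negP/sources_neq0.
Qed.

Lemma acyclic_fun0 : acyclic_fun set0 = 1.
Proof.
have /ffunP/(_ set0) := acyclic_funM; rewrite setfunM setfun1E eqxx.
rewrite (big_pred1 set0) => [|W]; last by rewrite subset0.
rewrite set0D [X in _ * X]ffunE cards0.
rewrite (_ : independent set0) ?mulr1 //.
by apply/independentP => u v; rewrite inE.
Qed.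

Definition source_fun := logder acyclic_fun signed_independent_fun.

(** The operator [euler v] confines the sum to the sets [W] that avoid [v], so [sum_sources] leaves
    the orientations with no source other than [v]; a nonempty [V] has at least one source. *)
Lemma source_funE v V : source_fun v V =
  #|[set g in acyclic_orientations V | sources V g == [set v]]|%:R.
Proof.
rewrite /source_fun /logder mulrC setfunM.
have [vV|vV] := boolP (v \in V); last first.
  rewrite big1 => [|W WV]; last by rewrite eulerE in_setD (negPf vV) andbF mulr0.
  rewrite (_ : [set g in _ | _] = set0) ?cards0 //.
  apply/setP => g; rewrite in_set0 inE; apply/negP => /andP[_ /eqP/setP/(_ v)].
  by rewrite !inE (negPf vV) eqxx.
transitivity (\sum_(W : {set T} | (W \subset V) && (W \subset ~: [set v]))
     signed_independent_fun W * acyclic_fun (V :\: W)).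
  rewrite big_mkcondr /=; apply: eq_bigr => W WV.
  rewrite eulerE in_setD vV andbT subsetC sub1set inE.
  by case: (v \in W) => /=; rewrite ?mulr1n ?mulr0.
rewrite sum_sources; congr (#|pred_of_set _|%:R); apply/setP => g; rewrite !inE.
apply: andb_id2l => gA; rewrite disjoint_sym disjoints_subset setCS.
rewrite subset1; apply/idP/idP => [|->//]; case/orP => // /eqP g0.
have := sources_neq0 (V := V) (g := g); rewrite inE => /(_ gA).
by rewrite g0 eqxx => /(_ _)/negP[]//; apply/set0Pn; exists v.
Qed.

Lemma euler_source_fun v w :
  v != w -> e v w -> euler w (source_fun v) = source_fun v * source_fun w.
Proof.
move=> vw evw; set B := source_fun.
pose A := acyclic_fun; pose I := signed_independent_fun.
have AI : A * I = 1 := acyclic_funM.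
have EI u : euler u I = - B u * I := logder_inv AI u.
have : euler w (euler v I) = 0.
  apply/ffunP => V; rewrite !eulerE [RHS]ffunE /I ffunE.
  have [vV|] := boolP (v \in V); last by rewrite mulr0n mul0rn.
  have [wV|] := boolP (w \in V); last by rewrite mulr0n.
  rewrite (_ : independent V = false) //.
  by apply/independentP => /(_ v w vV wV); rewrite evw.
rewrite EI eulerM eulerN EI => E0.
apply/eqP; rewrite -subr_eq0; apply/eqP.
(* Up to sign, [E0] is the claim multiplied by [I]; the factor [A] cancels it. *)
transitivity (- (- euler w (B v) * I + - B v * (- B w * I)) * A); last first.
  by rewrite E0 oppr0 mul0r.
rewrite [RHS](_ : _ = (euler w (B v) - B v * B w) * (A * I)); last by ring.
by rewrite AI mulr1.
Qed.

End AcyclicOrientations.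

(** * Proper colorings and powers of the independence function *)

Section Colorings.
Variables (T : finType) (e : rel T).
Implicit Types (f g : setfun T int) (V : {set T}).

(** A proper coloring is an ordered partition into independent color classes, some possibly empty,
    and the [k]-th convolution power counts these partitions. *)
Lemma card_proper_colorings k :
  #|proper_colorings e k|%:R = (independent_fun e ^+ k) setT.
Proof.
rewrite -(card_ord k) -prodr_const card_ord setfun_prodE.
transitivity (#|[set t : {ffun 'I_k -> {set T}} |
    disjoint_cover t setT && [forall l, independent e (t l)]]|%:R : int);
  last first.
  rewrite -sum1_card natr_sum.
  under eq_bigl do rewrite inE.
  rewrite [LHS]big_mkcondr /=; apply: eq_bigr => t _.
  under eq_bigr do rewrite ffunE.
  have [/forallP h|/forallPn[l /negPf hl]] :=
    boolP [forall l, independent e (t l)].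
    by rewrite big1 // => l _; rewrite h.
  by rewrite (bigD1 l) //= hl mul0r.
pose cells (c : {ffun T -> 'I_k}) : {ffun 'I_k -> {set T}} :=
  [ffun l => [set v | c v == l]].
have cells_inj : injective cells.
  move=> c1 c2 c12; apply/ffunP => v.
  have /ffunP/(_ (c2 v))/setP/(_ v) := c12.
  by rewrite !ffunE !inE eqxx => /eqP.
rewrite -(card_imset _ cells_inj); congr (#|pred_of_set _|%:R).
apply/setP => t; rewrite inE; apply/imsetP/andP => [[c]|[/andP[tD /eqP tC] tI]].
  rewrite inE => /forallP cP ->; split; last first.
    apply/forallP => l; apply/independentP => u v; rewrite ffunE !inE.
    move=> /eqP ul /eqP vl; apply/negP => uv.
    by have /forallP/(_ v)/implyP/(_ uv) := cP u; rewrite ul vl eqxx.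
  apply/andP; split.
    apply/forallP => k1; apply/forallP => k2; apply/implyP => /negPf k12.
    rewrite -setI_eq0; apply/eqP/setP => v; rewrite !ffunE !inE.
    by case: eqP => // ->; rewrite k12.
  apply/eqP/setP => v; rewrite inE; apply/bigcupP; exists (c v) => //.
  by rewrite ffunE inE.
have cover v : exists l, v \in t l.
  by have : v \in setT by []; rewrite -tC => /bigcupP[l _]; exists l.
have [c cP] := fin_all_exists cover.
have tE v l : (v \in t l) = (c v == l).
  apply/idP/eqP => [vl|<- //]; apply/eqP/negPn/negP => cl.
  have /forallP/(_ (c v))/forallP/(_ l)/implyP/(_ cl) := tD.
  by move=> /disjointFr/(_ (cP v)); rewrite vl.
exists [ffun v => c v].
  rewrite inE; apply/forallP => u; apply/forallP => v; apply/implyP => uv.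
  rewrite !ffunE; apply/negP => cuv.
  have /forallP/(_ (c v))/independentP/(_ u v) := tI.
  by rewrite !tE cuv eqxx uv => /(_ isT isT).
by apply/ffunP => l; apply/setP => v; rewrite ffunE inE ffunE tE.
Qed.

Definition sign_twist f : setfun T int :=
  [ffun V : {set T} => (-1) ^+ #|V| * f V].

(** Cardinality is additive over the two blocks, so the sign splits between the factors. *)
Lemma sign_twistM f g : sign_twist (f * g) = sign_twist f * sign_twist g.
Proof.
apply/ffunP => V; rewrite setfunM ffunE setfunM mulr_sumr.
apply: eq_bigr => W WV; rewrite !ffunE -[in LHS](cardsID W V) (setIidPr WV) exprD.
by ring.
Qed.

Lemma signed_independent_expr k :
  signed_independent_fun e ^+ k = sign_twist (independent_fun e ^+ k).
Proof.
elim: k => [|k IHk].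
  apply/ffunP => V; rewrite !expr0 [RHS]ffunE !setfun1E.
  by case: eqP => [->|_]; rewrite ?cards0 ?mulr0.
rewrite !exprS IHk sign_twistM; congr (_ * _).
by apply/ffunP => V; rewrite !ffunE mulr_natr.
Qed.

End Colorings.

(** * Polynomial-valued set functions *)

Lemma poly_eq_horner_nat (p q : {poly int}) :
  (forall k : nat, p.[k%:R] = q.[k%:R]) -> p = q.
Proof.
move=> pq; apply/eqP; rewrite -subr_eq0; apply/negPn/negP => pq0.
(* A nonzero polynomial has fewer distinct roots than its size, so this list is one root too
   long. *)
pose s := [seq Posz k | k <- iota 0 (size (p - q))].
have : (size s < size (p - q)%R)%N.
  apply: max_poly_roots => //.
    apply/allP => _ /mapP[k _ ->].
    by rewrite rootE hornerD hornerN -natz pq subrr.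
  by rewrite map_inj_uniq ?iota_uniq // => i j [].
by rewrite size_map size_iota ltnn.
Qed.

Section PolynomialFamilies.
Variable (T : finType).
Implicit Types (F G : setfun T {poly int}) (f g : setfun T int) (v : T).

Definition setfun_eval (m : int) F := setfun_map (horner_eval m) F.
Definition setfun_poly f : setfun T {poly int} := setfun_map polyC f.
Definition setfun_deriv F : setfun T {poly int} :=
  [ffun V : {set T} => (F V)^`()].

Lemma setfun_eval_poly m f : setfun_eval m (setfun_poly f) = f.
Proof. by apply/ffunP => V; rewrite !ffunE /= /horner_eval hornerC. Qed.

Lemma setfun_eval_const m p : setfun_eval m (setfun_const T p) =
  setfun_const T p.[m].
Proof. by apply/ffunP => V; rewrite !ffunE /= /horner_eval hornerMn. Qed.

Lemma setfun_evalM m F G :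
  setfun_eval m (F * G) = setfun_eval m F * setfun_eval m G.
Proof. exact: setfun_mapM. Qed.

Lemma setfun_evalP F G :
  (forall m, setfun_eval m F = setfun_eval m G) -> F = G.
Proof.
move=> FG; apply/ffunP => V; apply: poly_eq_horner_nat => k.
by have /ffunP/(_ V) := FG k%:R; rewrite !ffunE.
Qed.

Lemma setfun_derivM F G :
  setfun_deriv (F * G) = setfun_deriv F * G + F * setfun_deriv G.
Proof.
apply/ffunP => V; rewrite ffunE [RHS]ffunE !setfunM -big_split /= raddf_sum.
by apply: eq_bigr => W _; rewrite !ffunE /= derivM.
Qed.

Lemma setfun_deriv_poly f : setfun_deriv (setfun_poly f) = 0.
Proof. by apply/ffunP => V; rewrite !ffunE derivC. Qed.

Lemma setfun_deriv_constX : setfun_deriv (setfun_const T 'X) = 1.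
Proof. by apply/ffunP => V; rewrite !ffunE derivMn derivX. Qed.

Lemma euler_deriv v F : euler v (setfun_deriv F) = setfun_deriv (euler v F).
Proof. by apply/ffunP => V; rewrite !ffunE derivMn. Qed.

Lemma setfun_polyM f g :
  setfun_poly (f * g) = setfun_poly f * setfun_poly g.
Proof. exact: setfun_mapM. Qed.

Lemma euler_poly v f : euler v (setfun_poly f) = setfun_poly (euler v f).
Proof. exact: euler_map. Qed.

Lemma setfun_poly1 : setfun_poly 1 = 1.
Proof. by apply/ffunP => V; rewrite ffunE !setfun1E rmorph_nat. Qed.

Lemma setfun_poly_prod (s : seq T) (b : T -> setfun T int) :
  setfun_poly (\prod_(v <- s) b v) = \prod_(v <- s) setfun_poly (b v).
Proof. by rewrite (big_morph setfun_poly setfun_polyM setfun_poly1). Qed.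

End PolynomialFamilies.

(* A clique costs one linear factor per vertex: applying euler w to
   b_1 * .. * b_m * F multiplies it by (m + c) * b_w. *)
Lemma clique_factor (T : finType) (R : comNzRingType) (e : rel T) (c : R)
    (b : T -> setfun T R) (F : setfun T R) (s : seq T) :
    (forall u v, u != v -> e u v -> euler v (b u) = b u * b v) ->
    (forall v, euler v F = setfun_const T c * b v * F) ->
    pairwise (fun u v => (v != u) && e v u) s ->
  F setT =
    \prod_(k < size s) (c + k%:R) * ((\prod_(v <- s) b v) * F) setT.
Proof.
move=> Eb EF; elim: s => [|w s IHs] /=.
  by rewrite big_ord0 big_nil !mul1r.
case/andP => ws /IHs ->; rewrite big_ord_recr big_cons -[RHS]mulrA /=.
congr (_ * _); set p := \prod_(v <- s) b v.
(* [w] is adjacent to every vertex of [s], so by the Leibniz rule each factor [b v] contributes one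
   [b w]. *)
have Ep : euler w p = (size s)%:R * b w * p.
  rewrite /p; elim: (s) ws => [|v s' IHs'] /=.
    by rewrite big_nil euler1 !mul0r.
  case/andP => /andP[vw evw] /IHs' E; rewrite big_cons eulerM E Eb //.
  by rewrite mulrS; ring.
(* Every vertex lies in [setT], so [euler w] leaves this coefficient unchanged. *)
transitivity (euler w (p * F) setT); first by rewrite eulerE in_setT mulr1n.
rewrite eulerM Ep EF -setfun_const_mulE setfun_constD setfun_const_natr.
by congr ((_ : setfun T R) _); ring.
Qed.

(** * The polynomial family behind the chromatic polynomial *)

Section ChromaticFamily.
Variables (T : finType) (e : rel T).
Hypothesis e_sym : symmetric e.
Implicit Types (v : T) (V : {set T}).

Let A := acyclic_fun e.
Let I := signed_independent_fun e.
Let B := source_fun e.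
Let AI : A * I = 1 := acyclic_funM e_sym.
Let A0 : A set0 = 1 := acyclic_fun0 e_sym.

(** Identities valid at all integer exponents lift to polynomials. The last clause is checked at
    exponent -k, where [zpow] is a power of [I] and thus counts colorings up to sign. *)
Lemma chromatic_family : exists P : setfun T {poly int},
  [/\ forall m : int, setfun_eval m P = zpow A I m,
      P set0 = 1,
      forall v, euler v P = setfun_const T 'X * setfun_poly (B v) * P &
      chrom_poly e = (-1) ^+ #|T| *: (P setT \Po - 'X)].
Proof.
have [P PE] := zpow_poly AI A0.
have PA m : setfun_eval m P = zpow A I m.
  by apply/ffunP => V; rewrite ffunE; apply: PE.
exists P; split=> //.
- by apply: poly_eq_horner_nat => k; rewrite PE hornerC (zpow_set0 AI A0).
- move=> v; apply: setfun_evalP => m.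
  rewrite !setfun_evalM setfun_eval_const setfun_eval_poly hornerX PA.
  rewrite /setfun_eval -euler_map -/(setfun_eval m P) PA (euler_zpow AI).
  rewrite -mulrA; apply/ffunP => V.
  by rewrite setfun_const_mulE ffunMzE mulrzz mulrC.
apply: poly_eq_horner_nat => k; rewrite chrom_polyE card_proper_colorings.
rewrite hornerZ horner_comp hornerN hornerX PE.
have -> : zpow A I (- k%:R) = I ^+ k.
  by rewrite natz; case: k => [|k]; rewrite -?NegzE.
by rewrite /I signed_independent_expr ffunE cardsT mulrA -expr2 sqrr_sign mul1r.
Qed.

Variable P : setfun T {poly int}.
Hypotheses (PE : forall m : int, setfun_eval m P = zpow A I m)
  (P0 : P set0 = 1)
  (PB : forall v, euler v P = setfun_const T 'X * setfun_poly (B v) * P).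
Variable L : setfun T int.
Hypotheses (L0 : L set0 = 0) (EL : forall v, euler v L = B v).

(** The difference of the two sides vanishes at the empty set and satisfies the same Euler equations
    as [P]: the term [B v * P] arises on both sides and cancels. Hence [eq_setfun0] applies. *)
Lemma chromatic_family_deriv : setfun_deriv P = setfun_poly L * P.
Proof.
apply/eqP; rewrite -subr_eq0; apply/eqP.
apply: (@eq_setfun0 _ _ 'X (fun v => setfun_poly (B v))).
- by move=> v; rewrite [LHS]ffunE /B /source_fun logder_set0.
- rewrite !ffunE P0 derivC (big_pred1 set0) => [|V]; last by rewrite subset0.
  by rewrite ffunE L0 mul0r subr0.
move=> v; rewrite eulerD eulerN euler_deriv eulerM euler_poly EL PB.
rewrite !setfun_derivM setfun_deriv_poly setfun_deriv_constX.
by ring.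
Qed.

(** [f] and [L] are constant in q, so each differentiation only brings out another factor [L]. *)
Lemma derivn_chromatic_family (f : setfun T int) i V :
  ((setfun_poly f * P) V)^`(i) = (setfun_poly (f * L ^+ i) * P) V.
Proof.
elim: i => [|i IHi]; first by rewrite expr0 mulr1.
rewrite derivnS IHi.
have := setfun_derivM (setfun_poly (f * L ^+ i)) P.
rewrite setfun_deriv_poly mul0r add0r chromatic_family_deriv mulrA.
rewrite -setfun_polyM -mulrA -exprSr => /ffunP/(_ V) <-.
by rewrite [RHS]ffunE.
Qed.

End ChromaticFamily.

(** * Orientations whose unique source is the minimum *)

Section UniqueSource.
Variables (n : nat) (e : rel 'I_n).
Hypothesis e_sym : symmetric e.

Definition min_source_orientations (V : {set 'I_n}) :=
  [set g in acyclic_orientations e V |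
    (V != set0) && [exists m, is_min V m && (sources V g == [set m])]].

Definition min_source_fun : setfun 'I_n int :=
  [ffun V : {set 'I_n} => #|min_source_orientations V|%:R].

Lemma min_source_fun0 : min_source_fun set0 = 0.
Proof.
rewrite ffunE (_ : min_source_orientations _ = set0) ?cards0 //.
by apply/setP => g; rewrite !inE eqxx andbF.
Qed.

Lemma min_source_funE (V : {set 'I_n}) m :
  is_min V m -> min_source_fun V = source_fun e m V.
Proof.
move=> mmin; have /andP[mV /forall_inP mle] := mmin.
rewrite ffunE source_funE //; congr (#|pred_of_set _|%:R).
apply/setP => g; rewrite !inE; congr (_ && _).
have -> : V != set0 by apply/set0Pn; exists m.
apply/existsP/idP => [[m' /andP[/andP[m'V /forall_inP m'le]]]|sm].
  suff -> : m' = m by [].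
  by apply/val_inj/eqP; rewrite eqn_leq m'le ?mle.
by exists m; rewrite mmin.
Qed.

Lemma exists_min (V : {set 'I_n}) : V != set0 -> exists m, is_min V m.
Proof.
case/set0Pn => x xV; case: (@arg_minnP _ x [in V] (@nat_of_ord n) xV) => m mV mle.
by exists m; apply/andP; split=> //; apply/forall_inP.
Qed.

(* At q = 0 the derivative of euler v P = q * source_fun v * P shows that the
   number of acyclic orientations of V with unique source v does not depend on
   v \in V; hence min V may be replaced by v. *)
Lemma euler_min_source_fun v : euler v min_source_fun = source_fun e v.
Proof.
have [P [PE P0 PB _]] := chromatic_family e_sym.
pose D := setfun_eval 0 (setfun_deriv P).
have ED w : euler w D = source_fun e w.
  rewrite /D /setfun_eval euler_map euler_deriv PB !setfun_derivM.
  rewrite setfun_deriv_constX setfun_deriv_poly mulr0 addr0 mul1r.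
  apply/ffunP => V; rewrite ffunE /= /horner_eval [X in X.[_]]ffunE -mulrA.
  rewrite setfun_const_mulE hornerD hornerM hornerX mul0r addr0.
  (* At exponent 0 the family [P] is the unit, so only [source_fun e w] is left. *)
  have /ffunP/(_ V) := setfun_evalM 0 (setfun_poly (source_fun e w)) P.
  by rewrite setfun_eval_poly PE /= expr0 mulr1 ffunE.
rewrite -ED; congr (euler v _); apply/ffunP => V.
have [->|V0] := eqVneq V set0.
  by rewrite min_source_fun0 !ffunE P0 /= /horner_eval derivC horner0.
have [m mmin] := exists_min V0; rewrite (min_source_funE mmin) -ED eulerE.
by case/andP: mmin => ->.
Qed.

(** With [euler_min_source_fun], this reads [source_fun e v] as a count over blocks that contain [v]
    but have their minimum as unique source, which is what the first [d] entries of a tuple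
    require. *)
Lemma euler_min_source_funE v V :
  euler v min_source_fun V =
  #|[set g in min_source_orientations V | v \in V]|%:R.
Proof.
rewrite eulerE ffunE; case: (v \in V).
  rewrite mulr1n; congr (#|pred_of_set _|%:R); apply/setP => g.
  by rewrite [in RHS]inE andbT.
rewrite mulr0n (_ : [set g in _ | _] = set0) ?cards0 //.
by apply/setP => g; rewrite !inE andbF.
Qed.

End UniqueSource.

(** * Counting tuples of oriented blocks *)

Lemma card_disjoint_cover_tuples n m
    (G : 'I_m -> {set 'I_n} -> {set {set 'I_n * 'I_n}}) :
  (\sum_(t : {ffun 'I_m -> {set 'I_n}} | disjoint_cover t setT)
     \prod_k #|G k (t k)| =
   #|[set t : m.-tuple ({set 'I_n} * {set 'I_n * 'I_n}) |
      [&& [forall k, forall l, (k != l) ==>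
            [disjoint (tnth t k).1 & (tnth t l).1]],
          \bigcup_k (tnth t k).1 == setT
        & [forall k, (tnth t k).2 \in G k (tnth t k).1]]]|)%N.
Proof.
rewrite -[RHS]sum1_card.
transitivity (\sum_(t : {ffun 'I_m -> {set 'I_n}} | disjoint_cover t setT)
    \sum_(g in family (fun k => [in G k (t k)])) 1)%N.
  apply: eq_bigr => t _; under eq_bigr do rewrite -sum1_card.
  rewrite bigA_distr_big_dep; apply: eq_bigr => g _; exact: big1.
rewrite pair_big_dep /=.
(* A tuple of pairs is traded for a pair of families, the blocks and their orientations. *)
pose h (p : {ffun 'I_m -> {set 'I_n}} * {ffun 'I_m -> {set 'I_n * 'I_n}}) :=
  [tuple (p.1 k, p.2 k) | k < m].
pose h' (t : m.-tuple ({set 'I_n} * {set 'I_n * 'I_n})) :=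
  ([ffun k => (tnth t k).1], [ffun k => (tnth t k).2]).
rewrite [RHS](reindex_onto h h') /=; last first.
  move=> t _; apply: eq_from_tnth => k; rewrite tnth_mktuple /= !ffunE.
  by case: (tnth t k).
apply: eq_bigl => -[t g].
have -> : h' (h (t, g)) == (t, g).
  by apply/eqP; congr (_, _); apply/ffunP => k; rewrite ffunE tnth_mktuple.
rewrite andbT in_set /= /disjoint_cover -andbA.
congr (_ && (_ && _)).
- apply: eq_forallb => k; apply: eq_forallb => l.
  by rewrite !tnth_mktuple.
- by congr (_ == _); apply: eq_bigr => k _; rewrite tnth_mktuple.
by apply: eq_forallb => k; rewrite !tnth_mktuple.
Qed.

Lemma card_decompositions n (e : rel 'I_n) d (le_dn : (d <= n)%N) i j :
  symmetric e ->
  #|decompositions e d i j|%:R =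
  (\prod_(k < d) source_fun e (widen_ord le_dn k) * min_source_fun e ^+ i *
     acyclic_fun e ^+ j) setT.
Proof.
move=> e_sym.
(* [G k] gathers the conditions on entry [k] alone, including membership of the clique vertex;
   disjointness and covering come from the convolution. *)
pose G (k : nat) (V : {set 'I_n}) := [set g in acyclic_orientations e V |
  [forall v : 'I_n, (k < d)%N && (v == k :> nat) ==> (v \in V)] &&
  ((k < d + i)%N ==> (V != set0) &&
     [exists m, is_min V m && (sources V g == [set m])])].
pose w (k : 'I_(d + i + j)) : setfun 'I_n int :=
  [ffun V : {set 'I_n} => #|G k V|%:R].
transitivity ((\prod_k w k) setT).
  rewrite setfun_prodE.
  under eq_bigr do under eq_bigr do rewrite ffunE.
  under eq_bigr do rewrite -natr_prod.
  rewrite -natr_sum (card_disjoint_cover_tuples (fun k : 'I_(d + i + j) => G k)).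
  congr (#|pred_of_set _|%:R); apply/setP => t; rewrite !inE.
  congr (_ && (_ && _)); apply/andP/forallP => [[/forallP h1 /forallP h2] k|h].
    by rewrite inE (h1 k); have /and3P[ho ha ->] := h2 k; rewrite inE ho ha.
  split; apply/forallP => k; have := h k; rewrite inE => /and3P[] //.
  by rewrite inE => /andP[-> ->] _ ->.
(* The positions split into consecutive ranges of lengths [d], [i] and [j]; conditions foreign to a
   range hold vacuously there. *)
congr ((_ : setfun 'I_n int) _); rewrite !big_split_ord /=; congr (_ * _ * _).
- apply: eq_bigr => k _; rewrite -(euler_min_source_fun e_sym).
  apply/ffunP => V; rewrite ffunE euler_min_source_funE.
  congr (#|pred_of_set _|%:R); apply/setP => g; rewrite !inE -!andbA /=.
  rewrite ltn_addr //=; do 2!congr (_ && _); rewrite [RHS]andbA [RHS]andbC.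
  congr (_ && _); apply/forallP/idP => [/(_ (widen_ord le_dn k))|kV v].
    by rewrite /= ltn_ord eqxx.
  apply/implyP => /andP[_ /eqP vk].
  by rewrite (_ : v = widen_ord le_dn k) //; apply/val_inj.
- transitivity (\prod_(k < i) min_source_fun e); last first.
    by rewrite prodr_const card_ord.
  apply: eq_bigr => k _.
  apply/ffunP => V; rewrite !ffunE.
  congr (#|pred_of_set _|%:R); apply/setP => g; rewrite !inE /=.
  rewrite ltn_add2l ltn_ord [(d + k < d)%N]ltnNge leq_addr /=.
  by congr (_ && _); rewrite (_ : [forall v, _]) //; apply/forallP.
- transitivity (\prod_(k < j) acyclic_fun e); last first.
    by rewrite prodr_const card_ord.
  apply: eq_bigr => k _.
  apply/ffunP => V; rewrite !ffunE.
  congr (#|pred_of_set _|%:R); apply/setP => g; rewrite !inE /=.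
  rewrite ![(d + i + k < _)%N]ltnNge -addnA leq_addr addnA leq_addr /= andbT.
  by rewrite (_ : [forall v, _]) ?andbT //; apply/forallP.
Qed.

(** * The substitution of -q and the conclusion *)

Lemma derivn_comp_oppX (R : comNzRingType) (p : {poly R}) i :
  (p \Po - 'X)^`(i) = (-1) ^+ i *: (p^`(i) \Po - 'X).
Proof.
elim: i => [|i IHi]; first by rewrite expr0 scale1r.
rewrite !derivnS IHi derivZ deriv_comp derivN derivX.
by rewrite mulrN1 scalerN -scaleNr exprS mulN1r.
Qed.

Lemma rising_comp_oppX d :
  (\prod_(k < d) ('X + k%:R)) \Po - 'X =
  (-1) ^+ d *: \prod_(k < d) ('X - (k%:R)%:P) :> {poly int}.
Proof.
elim: d => [|d IHd]; first by rewrite !big_ord0 scale1r comp_polyC.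
rewrite !big_ord_recr /= comp_polyM IHd exprS mulN1r scaleNr -scalerAl -scalerN.
rewrite -mulrN opprB comp_polyD comp_polyX -polyC_natr comp_polyC.
by rewrite [_%:P + _]addrC.
Qed.

Theorem theorem4p5 (n : nat) (e : rel 'I_n) (e_sym : symmetric e)
    (e_irr : irreflexive e) (d : nat) (le_dn : (d <= n)%N)
    (clique : forall u v : 'I_n, (u < d)%N -> (v < d)%N -> u != v -> e u v) :
  exists chihat : {poly int},
    chrom_poly e = chihat * \prod_(k < d) ('X - (k%:R)%:P) /\
    forall i j : nat,
      (-1) ^ (n%:Z - d%:Z - i%:Z) * (chihat^`(i)).[- (j%:Z)] =
      #|decompositions e d i j|%:Z.
Proof.
have [P [PE P0 PB chromE]] := chromatic_family e_sym.
pose s := [seq widen_ord le_dn k | k <- enum 'I_d].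
(* The quotient polynomial, up to sign and the substitution of -q. *)
pose ph := (setfun_poly (\prod_(v <- s) source_fun e v) * P) setT.
have szs : size s = d by rewrite size_map size_enum_ord.
have s_clique : pairwise (fun u v => (v != u) && e v u) s.
  rewrite pairwise_map; have := enum_uniq 'I_d; rewrite uniq_pairwise.
  apply: sub_pairwise => k l /= kl.
  have lk : widen_ord le_dn l != widen_ord le_dn k.
    by rewrite -val_eqE /= eq_sym.
  by rewrite lk clique /=.
have PsetT : P setT = \prod_(k < d) ('X + k%:R) * ph.
  rewrite /ph setfun_poly_prod.
  rewrite (clique_factor (b := fun v => setfun_poly (source_fun e v)) _ PB
    s_clique).
    by rewrite szs.
  by move=> u v uv euv; rewrite euler_poly euler_source_fun // setfun_polyM.
(* The sign combines (-1)^n from [chromE] with (-1)^d from [rising_comp_oppX]. *)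
exists ((-1) ^+ (n - d) *: (ph \Po - 'X)); split.
  rewrite chromE PsetT card_ord comp_polyM rising_comp_oppX -!scalerAl scalerA.
  rewrite -[in LHS](subnK le_dn) exprD -mulrA -expr2 sqrr_sign mulr1.
  by rewrite mulrC.
move=> i j.
rewrite derivnZ derivn_comp_oppX !hornerZ horner_comp hornerN hornerX opprK.
rewrite /ph (derivn_chromatic_family P0 PB (min_source_fun0 e)
  (euler_min_source_fun e_sym)).
have -> : #|decompositions e d i j|%:Z =
  ((setfun_poly (\prod_(v <- s) source_fun e v * min_source_fun e ^+ i) * P)
     setT).[j].
  rewrite -natz (card_decompositions le_dn) //.
  have /ffunP/(_ setT) := setfun_evalM j (setfun_poly
    (\prod_(v <- s) source_fun e v * min_source_fun e ^+ i)) P.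
  rewrite setfun_eval_poly PE /= ffunE /= /horner_eval => ->.
  by rewrite big_map big_enum.
(* The exponent is negative when [i] exceeds [n - d]; this is harmless since -1 is its own
   inverse. *)
have -> : (-1) ^ (n%:Z - d%:Z - i%:Z) = (-1) ^+ (n - d) * (-1) ^+ i :> int.
  by rewrite subzn // exprzDr ?unitrN1 // -exprnN -exprVn invrN1.
by rewrite mulrACA -expr2 sqrr_sign mul1r mulrA -expr2 sqrr_sign mul1r.
Qed.
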